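(* For every instance of ROLDARP in which every request has revenue $1$, if $\mathrm{rev}(\mathrm{OPT}(t_{f-1}))+\mathrm{rev}(\mathrm{OPT}(t_f))\le c$ for a constant $c$, then $$\sum_{j=1}^{f}\mathrm{rev}(\mathrm{OPT}(t_j))\le 4\sum_{j=1}^{f}\mathrm{rev}(\mathrm{SBP}(t_j))+2\lceil f/2\rceil+c.$$
   Context: ROLDARP: an instance consists of a complete undirected graph $G=(V,E)$ with positive edge weights $w(u,v)$ (travel times), an origin $o\in V$, a time limit $T>0$, an integer $f$ with $1<f<T$ such that every edge weight is at most $T/f$, and a sequence of requests $(s,d,t,p)$ (source, destination, release time $t\ge0$, revenue $p>0$). A unit-capacity server starts at $o$ at time $0$; serving a request means travelling to $s$ and then from $s$ to $d$, starting from $s$ no earlier than $t$; at most one request is carried at a time, service is non-preemptive, and revenue $p$ is earned if the request is completed by time $T$. Requests become known to an online algorithm at their release times. $\mathrm{OPT}$ is an optimal offline schedule (knowing all requests in advance) maximizing total revenue. Time is split into $f$ segments $t_1,\dots,t_f$ of length $T/f$, where $t_j$ ends at time $jT/f$; $\mathrm{rev}(\mathrm{ALG}(t_j))$ denotes the total revenue of the requests that schedule $\mathrm{ALG}$ completes during segment $t_j$. Algorithm SBP (Segmented Best Path): if $f$ is odd, it stays idle during $t_1$ and sets $i=2$; otherwise $i=1$. While $i<f$: at the start of segment $t_i$ it computes a max-revenue-request-set $R$, namely, among requests released by that time and not yet served, a sequence of requests $r_1,\dots,r_\ell$ that can be served consecutively starting at the source of $r_1$ within total time at most $T/f$, of maximum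 total revenue. If $R$ is non-empty it moves to the source of $r_1$ during $t_i$ and serves $R$ during $t_{i+1}$; otherwise it stays idle during $t_i$ and $t_{i+1}$. Then $i$ is increased by $2$. *)

(* Defs.v *)
From HB Require Import structures.
From mathcomp Require Export all_boot all_order all_algebra.
From mathcomp Require Export reals.

Set Implicit Arguments.
Unset Strict Implicit.
Unset Printing Implicit Defensive.

Import Order.TTheory GRing.Theory Num.Theory.
Local Open Scope ring_scope.

Record request (R : realType) (V : finType) := Request {
  src : V;
  dst : V;
  release : R;
  revenue : R;
}.

(* Only the values [weight u v] with [u != v] are edge weights. The requests
   are indexed by ['I_nreq], so two requests may carry the same data. *)
Record instance (R : realType) := Instance {
  vertex : finType;
  weight : vertex -> vertex -> R;
  origin : vertex;
  Tlim : R;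
  nseg : nat;
  nreq : nat;
  req : 'I_nreq -> request R vertex;
  weight_sym : forall u v, weight u v = weight v u;
  weight_gt0 : forall u v, u != v -> 0 < weight u v;
  Tlim_gt0 : 0 < Tlim;
  nseg_gt1 : (1 < nseg)%N;
  nseg_lt : nseg%:R < Tlim;
  weight_le : forall u v, u != v -> weight u v <= Tlim / nseg%:R;
  release_ge0 : forall k, 0 <= release (req k);
  revenue_gt0 : forall k, 0 < revenue (req k);
}.

Section ROLDARP.
Variables (R : realType) (I : instance R).
Local Notation V := (vertex I).
Local Notation f := (nseg I).
Local Notation T := (Tlim I).
Implicit Types (u v pos : V) (tau now : R) (k : 'I_(nreq I)).

Definition rsrc k : V := src (req k).
Definition rdst k : V := dst (req k).
Definition rrel k : R := release (req k).
Definition rrev k : R := revenue (req k).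

Fixpoint walk_time u (p : seq V) : R :=
  if p is v :: p' then weight u v + walk_time v p' else 0.

(* The server can get from [u] to [v] in at most [tau] units of time. No
   triangle inequality is assumed, so it may use any walk of the graph; the
   empty walk gives [u = v] and [0 <= tau]. *)
Definition travel u v tau : Prop :=
  exists p : seq V,
    [/\ path (fun x y => x != y) u p, last u p = v & walk_time u p <= tau].

Record ride := Ride { rid : 'I_(nreq I); pickup : R; dropoff : R }.

Definition schedule := seq ride.

(* A server that is at [pos] at time [now] can carry out the rides of [S] one
   after the other. Each ride ends before the next one begins, which is unit
   capacity and non-preemption; waiting is allowed at any moment. *)
Fixpoint feasible pos now (S : schedule) : Prop :=
  if S is r :: S' then
    [/\ travel pos (rsrc (rid r)) (pickup r - now),
        rrel (rid r) <= pickup r,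
        travel (rsrc (rid r)) (rdst (rid r)) (dropoff r - pickup r)
      & feasible (rdst (rid r)) (dropoff r) S']
  else True.

Definition valid_schedule (S : schedule) : Prop :=
  uniq (map rid S) /\ feasible (origin I) 0 S.

Definition total_revenue (S : schedule) : R :=
  \sum_(r <- S | dropoff r <= T) rrev (rid r).

Definition optimal_schedule (S : schedule) : Prop :=
  valid_schedule S /\
  forall S', valid_schedule S' -> total_revenue S' <= total_revenue S.

(* Segment [t_j], for [1 <= j <= f], starts at [seg_end j.-1]. *)
Definition seg_end (j : nat) : R := j%:R * (T / f%:R).

(* Each segment contains its right endpoint, so that a request completed
   exactly at [T] counts in [t_f] and no completion is counted twice; [t_1]
   also contains time [0], for a request with [src = dst] completed then. *)
Definition in_segment (j : nat) (x : R) : bool :=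
  if j == 1%N then 0 <= x <= seg_end 1 else seg_end j.-1 < x <= seg_end j.

Definition seg_revenue (S : schedule) (j : nat) : R :=
  \sum_(r <- S | in_segment j (dropoff r)) rrev (rid r).

Fixpoint served_from pos (ks : seq 'I_(nreq I)) tau : Prop :=
  if ks is k :: ks' then
    exists tau1 tau2 : R,
      [/\ travel pos (rsrc k) tau1, travel (rsrc k) (rdst k) tau2
        & served_from (rdst k) ks' (tau - (tau1 + tau2))]
  else 0 <= tau.

Definition servable_within (ks : seq 'I_(nreq I)) tau : Prop :=
  if ks is k :: _ then served_from (rsrc k) ks tau else True.

Definition candidate now (done ks : seq 'I_(nreq I)) : Prop :=
  [/\ uniq ks,
      {in ks, forall k, rrel k <= now /\ k \notin done}
    & servable_within ks (T / f%:R)].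

Definition max_revenue_request_set now (done ks : seq 'I_(nreq I)) : Prop :=
  candidate now done ks /\
  forall ks', candidate now done ks' ->
    \sum_(k <- ks') rrev k <= \sum_(k <- ks) rrev k.

(* [sbp_from i pos done S]: when SBP is at [pos] at the start of [t_i] and has
   already served [done], [S] is a possible list of its remaining rides. This
   is a relation because ties between request sets of maximum revenue, and the
   timing of the rides inside [t_(i+1)], are not prescribed. *)
Inductive sbp_from : nat -> V -> seq 'I_(nreq I) -> schedule -> Prop :=
| sbp_stop i pos done :
    (f <= i)%N -> sbp_from i pos done [::]
| sbp_idle i pos done S :
    (i < f)%N ->
    max_revenue_request_set (seg_end i.-1) done [::] ->
    sbp_from i.+2 pos done S ->
    sbp_from i pos done S
| sbp_serve i pos done k ks S S' :
    (i < f)%N ->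
    max_revenue_request_set (seg_end i.-1) done (k :: ks) ->
    travel pos (rsrc k) (seg_end i - seg_end i.-1) ->
    map rid S = k :: ks ->
    feasible (rsrc k) (seg_end i) S ->
    all (fun r => dropoff r <= seg_end i.+1) S ->
    sbp_from i.+2 (rdst (last k ks)) (done ++ k :: ks) S' ->
    sbp_from i pos done (S ++ S').

Definition sbp_schedule (S : schedule) : Prop :=
  sbp_from (if odd f then 2 else 1)%N (origin I) [::] S.

End ROLDARP.

(* Main.v *)
Require Import Defs.
From mathcomp Require Import all_boot all_order all_algebra.
From mathcomp Require Import reals.
From mathcomp Require Import zify lra.

Import Order.TTheory GRing.Theory Num.Theory.
Local Open Scope ring_scope.

(** Compare the request set [R_i] that SBP picks at the start of [t_i] with the
    requests that OPT completes in one earlier segment and that SBP never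
    serves. All but the first of the latter are picked up and delivered inside
    that segment, so they are a candidate for [R_i], and the segment contains
    at most [1 + |R_i|] of them. Charging [t_(i-2)] and [t_(i-1)] to [R_i]
    covers all segments but the last two, which gives
    [2 |SBP| + 2 * ceil (f / 2)]; the requests of OPT that SBP does serve add
    at most [|SBP|]. *)

Section ChargingArgument.
Set Implicit Arguments.
Unset Strict Implicit.
Variables (R : realType) (I : instance R).
Local Notation V := (vertex I).
Local Notation f := (nseg I).
Local Notation T := (Tlim I).
Implicit Types (u v pos : V) (tau now : R) (S : schedule I).
Implicit Types (ks done Z : seq 'I_(nreq I)).

(** * Walks and travel times *)

Lemma walk_time_ge0 u (p : seq V) :
  path (fun x y => x != y) u p -> 0 <= walk_time u p.
Proof.
elim: p u => //= v p IHp u /andP[uv /IHp].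
by have := weight_gt0 uv; lra.
Qed.

Lemma travel_ge0 u v tau : travel u v tau -> 0 <= tau.
Proof. by case=> p [/walk_time_ge0 w0 _]; apply: le_trans. Qed.

Lemma travel_refl u : travel u u 0.
Proof. by exists [::]. Qed.

Lemma walk_time_cat u (p q : seq V) :
  walk_time u (p ++ q) = walk_time u p + walk_time (last u p) q.
Proof. by elim: p u => /= [|v p IHp] u; rewrite ?add0r // IHp addrA. Qed.

Lemma travel_trans u v pos (a b : R) :
  travel u v a -> travel v pos b -> travel u pos (a + b).
Proof.
move=> [p [pp <- wp]] [q [pq <- wq]]; exists (p ++ q).
by rewrite cat_path pp pq last_cat walk_time_cat lerD.
Qed.

Lemma travel_via u v pos (x y z : R) :
  travel u v (y - x) -> travel v pos (z - y) -> travel u pos (z - x).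
Proof.
by move=> uv /(travel_trans uv); rewrite [X in travel _ _ X](_ : _ = z - x) //; lra.
Qed.

(** * Feasible schedules and the request sets extracted from them *)

Lemma feasible_dropoff_ge pos now S :
  feasible pos now S -> all (fun r => now <= dropoff r) S.
Proof.
elim: S pos now => //= r S IHS pos now [/travel_ge0 t1 _ /travel_ge0 t2 /IHS].
have le_r : now <= dropoff r by lra.
by rewrite le_r; apply: sub_all => r'; apply: le_trans.
Qed.

Lemma feasible_release_le pos now S :
  feasible pos now S -> all (fun r => rrel (rid r) <= dropoff r) S.
Proof.
elim: S pos now => //= r S IHS pos now [_ rel_r /travel_ge0 t2 /IHS ->].
by rewrite andbT; lra.
Qed.

Lemma served_from_le pos ks (a b : R) :
  a <= b -> served_from pos ks a -> served_from pos ks b.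
Proof.
elim: ks pos a b => /= [|k ks IHks] pos a b ab; first by move/le_trans; apply.
move=> [t1 [t2 [h1 h2 h3]]]; exists t1, t2; split=> //.
by apply: IHks h3; lra.
Qed.

(** [servable_within] starts the clock at the source of the first request, so dropping the approach
    from [pos] only saves time. *)
Lemma served_from_servable pos ks tau :
  served_from pos ks tau -> servable_within ks tau.
Proof.
case: ks => //= k ks [t1 [t2 [/travel_ge0 h1 h2 h3]]].
exists 0, t2; split=> //; first exact: travel_refl.
by apply: served_from_le h3; lra.
Qed.

(** In the induction, [pos0] and [now0] tell where and when the last kept ride ended, while [pos]
    and [now] follow the whole schedule. A ride outside [P] is absorbed into the walk to the next
    kept pickup, as [travel] allows any walk. *)
Lemma feasible_served_from (P : pred (ride I)) (b : R) pos0 now0 pos now S :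
    travel pos0 pos (now - now0) -> feasible pos now S -> now0 <= b ->
    (forall r, P r -> dropoff r <= b) ->
  served_from pos0 (map (@rid _ _) (filter P S)) (b - now0).
Proof.
move=> + + + Pb; elim: S pos0 now0 pos now => /= [|r S IHS] pos0 now0 pos now.
  by move=> _ _; lra.
move=> t0 [t1 _ t2 feasS] now0b; have t01 := travel_via t0 t1.
case: ifPn => [/Pb rb /= | _]; last first.
  exact: IHS (travel_via t01 t2) feasS now0b.
exists (pickup r - now0), (dropoff r - pickup r); split=> //.
rewrite [X in served_from _ _ X](_ : _ = b - dropoff r); last by lra.
apply: IHS feasS rb; rewrite subrr; exact: travel_refl.
Qed.

(* The first ride completed in [[a, b]] is dropped, as it may start before [a]. *)
Lemma feasible_behead_servable (P : pred (ride I)) (a b : R) pos now S :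
    feasible pos now S -> (forall r, P r -> a <= dropoff r <= b) ->
  servable_within (behead (map (@rid _ _) (filter P S))) (b - a).
Proof.
move=> + Pab; elim: S pos now => //= r S IHS pos now [_ _ _ feasS].
case: ifPn => [/Pab /andP[ra rb] /= | _]; last exact: IHS feasS.
apply: (@served_from_servable (rdst (rid r))).
apply: (@served_from_le _ _ (b - dropoff r)); first by lra.
apply: feasible_served_from feasS rb _; last by move=> r' /Pab /andP[].
by rewrite subrr; apply: travel_refl.
Qed.

(** * Time segments *)

Lemma seg_len_gt0 : 0 < T / f%:R.
Proof.
by rewrite divr_gt0 ?Tlim_gt0 // ltr0n; apply: ltnW (nseg_gt1 I).
Qed.

Lemma seg_end_ge0 j : 0 <= seg_end I j.
Proof. by rewrite mulr_ge0 // ltW // seg_len_gt0. Qed.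

Lemma seg_end_le i j : (i <= j)%N -> seg_end I i <= seg_end I j.
Proof. by move=> ij; rewrite ler_wpM2r ?ler_nat // ltW // seg_len_gt0. Qed.

Lemma seg_endS j : seg_end I j.+1 - seg_end I j = T / f%:R.
Proof. by rewrite /seg_end -mulrBl -natrB // subSnn mul1r. Qed.

Lemma in_segment_bounds j (x : R) :
  in_segment I j x -> seg_end I j.-1 <= x <= seg_end I j.
Proof.
rewrite /in_segment; case: eqP => [->|_]; first by rewrite {2}/seg_end mul0r.
by case/andP=> /ltW -> ->.
Qed.

(** Since [0.-1] is [0], both ends of this interval coincide. The charging sums may thus start at
    [j = 0], where the truncated [i - 2] puts them when [i <= 2]. *)
Lemma in_segment0 (x : R) : in_segment I 0 x = false.
Proof. by rewrite /in_segment /=; case: ltP => // h; rewrite leNgt h. Qed.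

Lemma sum_in_segment n (x : R) : (0 < n)%N ->
  (\sum_(1 <= j < n.+1) in_segment I j x)%N = (0 <= x <= seg_end I n) :> nat.
Proof.
elim: n => // -[_ _|n /(_ isT) IHn _]; first by rewrite big_nat1.
rewrite big_nat_recr //= {}IHn /in_segment /=.
have := seg_end_ge0 n.+1; have := @seg_end_le n.+1 n.+2 (leqnSn _).
case: (leP 0 x); case: (leP x (seg_end I n.+1)); case: (leP x (seg_end I n.+2)) => //= *;
  by exfalso; lra.
Qed.

(** * Counting rides by segment *)

Definition seg_count (P : pred (ride I)) S j : nat :=
  count (fun r => in_segment I j (dropoff r) && P r) S.

Lemma seg_countC P S j :
  seg_count predT S j = (seg_count (fun r => ~~ P r) S j + seg_count P S j)%N.
Proof.
rewrite /seg_count; elim: S => //= r S ->.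
by case: (in_segment _ _ _); case: (P r) => //=; lia.
Qed.

Lemma sum_seg_count P S n : (0 < n)%N ->
  (\sum_(1 <= j < n.+1) seg_count P S j)%N =
  count (fun r => (0 <= dropoff r <= seg_end I n) && P r) S.
Proof.
move=> n0; elim: S => [|r S IHS]; first by rewrite big1.
rewrite /= -IHS big_split /=; congr addn.
case: (P r); last by rewrite big1 ?andbF // => j _; rewrite andbF.
by rewrite andbT -sum_in_segment //; apply: eq_bigr => j _; rewrite andbT.
Qed.

Lemma count_rid_le (s : seq 'I_(nreq I)) S :
  uniq (map (@rid _ _) S) -> (count (fun r => rid r \in s) S <= size s)%N.
Proof.
move=> uS; rewrite -(count_map _ (mem s)) -size_filter.
by apply: uniq_leq_size; [exact: filter_uniq | move=> k; rewrite mem_filter => /andP[]].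
Qed.

(** An iteration at [i < f] delivers during [t_(i+1)], which ends by the time limit. Hence every
    ride of SBP is counted in some segment. *)
Lemma sbp_from_dropoff i pos done S : sbp_from i pos done S ->
  all (fun r => 0 <= dropoff r <= seg_end I f) S.
Proof.
elim=> // {}i {}pos {}done k ks S1 S2 ltif _ _ _ feasS1 dropS1 _ IH.
rewrite all_cat IH andbT.
have : all (predI (fun r => seg_end I i <= dropoff r)
                  (fun r => dropoff r <= seg_end I i.+1)) S1.
  by rewrite all_predI (feasible_dropoff_ge feasS1).
apply: sub_all => r /andP[ge_r le_r].
by rewrite (le_trans (seg_end_ge0 _) ge_r) (le_trans le_r (seg_end_le ltif)).
Qed.

(** * Charging under unit revenues *)

Section UnitRevenue.
Hypothesis unit_revenue : forall k : 'I_(nreq I), revenue (req k) = 1.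

Lemma seg_revenueE S j : seg_revenue S j = (seg_count predT S j)%:R.
Proof.
rewrite /seg_revenue /seg_count.
under eq_bigr do rewrite /rrev unit_revenue.
rewrite -big_filter big_const_seq count_predT size_filter iter_addr_0.
by congr (_%:R); apply: eq_count => r; rewrite andbT.
Qed.

Lemma sum_rrev ks : \sum_(k <- ks) rrev k = (size ks)%:R.
Proof.
under eq_bigr do rewrite /rrev unit_revenue.
by rewrite big_const_seq count_predT iter_addr_0.
Qed.

(** [Z] stands for all requests that SBP ever serves. It stays fixed while [done] grows, so the same
    counts of OPT are bounded at every iteration. The successor pays for the first ride, lost to
    [behead]. *)
Lemma seg_count_le_max_set S Z i j done ks :
    valid_schedule S -> {subset done <= Z} -> (j < i)%N ->
    max_revenue_request_set (seg_end I i.-1) done ks ->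
  (seg_count (fun r => rid r \notin Z) S j <= (size ks).+1)%N.
Proof.
move=> [uS feasS] doneZ ji [_ maxks].
case: j ji => [|j] ji.
  by rewrite /seg_count (eq_count (a2 := pred0)) ?count_pred0 // => r; rewrite in_segment0.
rewrite /seg_count -size_filter.
set P := fun r => _ && _; set ks' := behead (map (@rid _ _) (filter P S)).
suff /maxks : candidate (seg_end I i.-1) done ks'.
  by rewrite !sum_rrev ler_nat size_behead size_map; lia.
split.
- by rewrite /ks' -drop1 drop_uniq // filter_mask map_mask mask_uniq.
- suff /allP avail : all (fun k => (rrel k <= seg_end I i.-1) && (k \notin done))
      (map (@rid _ _) (filter P S)).
    by move=> k /mem_behead /avail /andP[].
  (* A request is released before its completion, here by the end of a segment preceding [t_i], so
     SBP knows it at the start of [t_i]. *)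
  rewrite all_map all_filter; apply: sub_all (feasible_release_le feasS) => r rel_r.
  apply/implyP=> /andP[/in_segment_bounds /andP[_ le_r] rZ] /=; apply/andP; split.
    by rewrite (le_trans rel_r) // (le_trans le_r) // seg_end_le //; lia.
  by apply: contra rZ => /doneZ.
- rewrite -(seg_endS j); apply: feasible_behead_servable feasS _.
  by move=> r /andP[/in_segment_bounds].
Qed.

(* Parity makes the last iteration happen at [i = f - 1], so that no segment
   before [t_(f-1)] is left uncharged when SBP stops. *)
Lemma sum_seg_count_le_sbp S Z i pos done S' :
    valid_schedule S -> sbp_from i pos done S' -> (0 < i)%N -> odd (f + i) ->
    {subset done <= Z} -> {subset map (@rid _ _) S' <= Z} ->
  (\sum_(i - 2 <= j < f.-1) seg_count (fun r => rid r \notin Z) S j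
     <= 2 * size S' + (f.+1 - i))%N.
Proof.
move=> vS run; set X := seg_count _ S.
(* One iteration pays for [t_(l-2)] and [t_(l-1)], at most [(size ks).+1] each. The two extra units
   per iteration, idle or not, are paid by [f.+1 - i], which drops by two. *)
have step l ks done' : (l < f)%N -> {subset done' <= Z} ->
    max_revenue_request_set (seg_end I l.-1) done' ks ->
    (\sum_(l - 2 <= j < f.-1) X j <=
       2 * (size ks).+1 + \sum_(l.+2 - 2 <= j < f.-1) X j)%N.
  move=> lf doneZ maxks; rewrite subSS subn1 /= (@big_cat_nat _ _ _ l) /=; [|lia|lia].
  rewrite leq_add2r.
  apply: (@leq_trans (\sum_(l - 2 <= j < l) (size ks).+1)%N); last first.
    by rewrite sum_nat_const_nat leq_mul2r; apply/orP; right; lia.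
  rewrite !big_nat; apply: leq_sum => j /andP[_ jl].
  exact: seg_count_le_max_set maxks.
elim: run => {i pos done S'} [i pos done fi|i pos done S' lif maxR _ IH|
    i pos done k ks S1 S' lif maxR _ ridS1 _ _ _ IH] i0 oddfi doneZ subZ.
- by rewrite big_geq //; lia.
- have /= := step _ _ _ lif doneZ maxR.
  by have := IH isT ltac:(lia) doneZ subZ; lia.
- have subZ1 x : x \in k :: ks -> x \in Z.
    by move=> xR; apply: subZ; rewrite map_cat mem_cat ridS1 xR.
  have size_S1 : size S1 = (size ks).+1 by rewrite -(size_map (@rid _ _)) ridS1.
  have doneZ' : {subset done ++ k :: ks <= Z}.
    by move=> x; rewrite mem_cat => /orP[/doneZ|/subZ1].
  have subZ' : {subset map (@rid _ _) S' <= Z}.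
    by move=> x xS; apply: subZ; rewrite map_cat mem_cat xS orbT.
  have /= := step _ _ _ lif doneZ maxR; rewrite size_cat size_S1.
  by have := IH isT ltac:(lia) doneZ' subZ'; lia.
Qed.

End UnitRevenue.
End ChargingArgument.

Theorem theorem4 (R : realType) (I : instance R) (OPT SBP : schedule I) (c : R)
    (unit_revenue : forall k : 'I_(nreq I), revenue (req k) = 1)
    (OPT_optimal : optimal_schedule OPT)
    (SBP_run : sbp_schedule SBP)
    (OPT_last : seg_revenue OPT (nseg I).-1 + seg_revenue OPT (nseg I) <= c) :
  \sum_(1 <= j < (nseg I).+1) seg_revenue OPT j <=
    4 * (\sum_(1 <= j < (nseg I).+1) seg_revenue SBP j)
      + 2 * (Num.ceil ((nseg I)%:R / 2 : R))%:~R + c.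
Proof.
have f1 := nseg_gt1 I; case: OPT_optimal => vOPT _.
have seg_revE S j := @seg_revenueE _ I unit_revenue S j.
have -> : \sum_(1 <= j < (nseg I).+1) seg_revenue SBP j = (size SBP)%:R.
  under eq_bigr do rewrite seg_revE.
  rewrite -natr_sum sum_seg_count; last by lia.
  congr (_%:R); apply/eqP; rewrite -all_count.
  by apply: sub_all (sbp_from_dropoff SBP_run) => r ->.
set Z := map (@rid _ _) SBP.
have early : (\sum_(1 <= j < (nseg I).-1) seg_count predT OPT j
    <= 3 * size SBP + nseg I)%N.
  have unserved : (\sum_(1 <= j < (nseg I).-1) seg_count (fun r => rid r \notin Z) OPT j
      <= 2 * size SBP + nseg I)%N.
    (* The index of SBP's first iteration, whose parity is opposite to that of [f]. *)
    pose i0 := (if odd (nseg I) then 2 else 1)%N.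
    have i0_le2 : (0 < i0 <= 2)%N by rewrite /i0; case: ifP.
    have odd_i0 : odd (nseg I + i0) by rewrite oddD /i0; case: (odd (nseg I)).
    have := sum_seg_count_le_sbp unit_revenue (Z := Z) vOPT SBP_run ltac:(lia) odd_i0.
    rewrite -/i0 (_ : i0 - 2 = 0)%N; last by lia.
    (* The charging sum starts at [j = 0]; its extra nonnegative term is split off and discarded. *)
    rewrite big_ltn; last by lia.
    by move=> /(_ (fun _ => ltac:(by [])) (fun _ => id)); lia.
  have served : (\sum_(1 <= j < (nseg I).-1) seg_count (fun r => rid r \in Z) OPT j
      <= size SBP)%N.
    (* Extended to all [f] segments, the sum counts rides of OPT with distinct requests in [Z]. *)
    have := sum_seg_count (fun r => rid r \in Z) OPT (ltnW f1).
    rewrite (@big_cat_nat _ _ _ (nseg I).-1) /=; [|lia|lia] => sumE.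
    have : (count (fun r => (0 <= dropoff r <= seg_end I (nseg I))%R && (rid r \in Z)) OPT
        <= size Z)%N.
      by apply: leq_trans (count_rid_le Z vOPT.1); apply: sub_count => r /andP[].
    by rewrite size_map -sumE; apply: leq_trans; apply: leq_addr.
  under eq_bigr do rewrite (seg_countC (fun r => rid r \in Z)).
  by rewrite big_split; apply: leq_trans (leq_add unserved served) _; lia.
have -> : \sum_(1 <= j < (nseg I).+1) seg_revenue OPT j =
    (\sum_(1 <= j < (nseg I).-1) seg_count predT OPT j)%:R +
      (seg_revenue OPT (nseg I).-1 + seg_revenue OPT (nseg I)).
  rewrite natr_sum (eq_bigr _ (fun j _ => seg_revE OPT j)) !seg_revE.
  by rewrite -{1}(prednK (ltnW f1)) !big_nat_recr ?addrA ?prednK //; lia.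
(* This turns the term [f] of [early] into [2 * ceil (f / 2)]; nonnegativity of [size SBP] lets the
   factor 3 grow to 4. *)
have ceil_ge := @Num.Theory.ceil_ge R ((nseg I)%:R / 2).
have size_ge0 : 0 <= (size SBP)%:R :> R by [].
move: early; rewrite -(ler_nat R) natrD natrM.
lra.
Qed.
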